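(* Let $\hat T$ be an isotropic Biot stress response and let $F\in\mathrm{GL}^+(3)$ be an idealized shear deformation such that $\hat T(F^TF)$ is a non-trivial pure shear stress, i.e. $\hat T(F^TF)=s\,(e_1\otimes e_2+e_2\otimes e_1)$ with $s\in\mathbb{R}\setminus\{0\}$. Then $F$ is a right finite simple shear deformation, i.e. there exists $\alpha\in\mathbb{R}$ with $$F=\frac{1}{\sqrt{\cosh(2\alpha)}}\begin{pmatrix}\cosh(2\alpha)&\sinh(2\alpha)&0\\0&1&0\\0&0&\sqrt{\cosh(2\alpha)}\end{pmatrix}.$$
   Context: $e_1,e_2,e_3$ is the standard basis of $\mathbb{R}^3$. $\mathrm{GL}^+(3)$ denotes the real $3\times3$ matrices with positive determinant, $\mathrm{Sym}(3)$ the symmetric real $3\times 3$ matrices and $\mathrm{Sym}^+(3)$ the positive definite symmetric ones. An isotropic Biot stress response is a map $\hat T:\mathrm{Sym}^+(3)\to\mathrm{Sym}(3)$ with $\hat T(QCQ^T)=Q\hat T(C)Q^T$ for all $Q\in\mathrm{SO}(3)$ and $C\in\mathrm{Sym}^+(3)$; the Biot stress corresponding to $F\in\mathrm{GL}^+(3)$ is $\hat T(F^TF)$. A matrix $F=VR\in\mathrm{GL}^+(3)$ with $V\in\mathrm{Sym}^+(3)$ and $R\in\mathrm{SO}(3)$ (left polar decomposition) is called an idealized (finite) shear deformation if: (i) the stretch $V$ (or, equivalently, the deformation $F$) is volume preserving, i.e. $\det V=1$; (ii) the stretch $V$ is planar, i.e. $V$ has the eigenvalue $1$ to the eigenvector $e_3$;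 (iii) the rotation $R$ is such that $F$ is ground parallel, i.e. $e_1$ and $e_3$ are eigenvectors of $F$. In the theorem this is read as: $\det F=1$, $e_3$ is an eigenvector of $F$ for the eigenvalue $1$, and $e_1$ is an eigenvector of $F$.
   Formalization: It is additionally assumed that the eigenvalue of F for e1 (its entry F_11) is positive; otherwise the claim fails, e.g. for F = diag(-1,-1,1) times a right simple shear with T(C) = C - C^{-1}, while the conclusion forces F_11 > 0. *)

(* Defs.v *)
From HB Require Import structures.
From mathcomp Require Import all_boot all_order all_algebra.
From mathcomp Require Import reals sequences exp.

Set Implicit Arguments.
Unset Strict Implicit.
Unset Printing Implicit Defensive.

Import Order.TTheory GRing.Theory Num.Theory.
Local Open Scope ring_scope.

Definition cosh (R : realType) (x : R) : R := (expR x + expR (- x)) / 2.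
Definition sinh (R : realType) (x : R) : R := (expR x - expR (- x)) / 2.

(* Indices of 'I_3 start at 0. *)
Definition e1 (R : realType) : 'cV[R]_3 := delta_mx 0 0.
Definition e2 (R : realType) : 'cV[R]_3 := delta_mx 1 0.
Definition e3 (R : realType) : 'cV[R]_3 := delta_mx 2 0.
Arguments e1 {R}.
Arguments e2 {R}.
Arguments e3 {R}.

Definition tensor (R : realType) (u v : 'cV[R]_3) : 'M[R]_3 := u *m v^T.

Definition GLp (R : realType) (F : 'M[R]_3) : Prop := 0 < \det F.

Definition SO (R : realType) (Q : 'M[R]_3) : Prop :=
  Q^T *m Q = 1%:M /\ \det Q = 1.

Definition Sym (R : realType) (A : 'M[R]_3) : Prop := A^T = A.

Definition Symp (R : realType) (A : 'M[R]_3) : Prop :=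
  Sym A /\ forall x : 'cV[R]_3, x != 0 -> 0 < (x^T *m A *m x) 0 0.

(* A map Sym^+(3) -> Sym(3) is encoded by a total function on matrices whose
   values outside Sym^+(3) are unconstrained. *)
Definition isotropic_biot_response (R : realType)
    (T : 'M[R]_3 -> 'M[R]_3) : Prop :=
  (forall C, Symp C -> Sym (T C)) /\
  (forall Q C, SO Q -> Symp C -> T (Q *m C *m Q^T) = Q *m T C *m Q^T).

(* The eigenvalue of F for e1 may have either sign here. *)
Definition idealized_shear (R : realType) (F : 'M[R]_3) : Prop :=
  [/\ \det F = 1,
      F *m e3 = e3
    & exists l : R, F *m e1 = l *: e1].

Definition pure_shear_stress (R : realType) (s : R) : 'M[R]_3 :=
  s *: (tensor e1 e2 + tensor e2 e1).

Definition mx3 (R : realType) (rows : seq (seq R)) : 'M[R]_3 :=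
  \matrix_(i < 3, j < 3) nth 0 (nth [::] rows i) j.

Definition right_simple_shear (R : realType) (alpha : R) : 'M[R]_3 :=
  let c := cosh (2 * alpha) in
  let s := sinh (2 * alpha) in
  (Num.sqrt c)^-1 *: mx3 [:: [:: c; s; 0];
                             [:: 0; 1; 0];
                             [:: 0; 0; Num.sqrt c]].

(* Main.v *)
(* An eigenvector v of C is fixed by the half-turn Q about v, and Q commutes
   with C. Isotropy then makes Q commute with the stress, so v is an eigenvector
   of the stress as well. A non-trivial pure shear stress has simple spectrum
   with eigenvectors e1 + e2, e1 - e2 and e3, so the tridiagonal matrix
   C = F^T F must have C e3 = e3 and equal first two diagonal entries. With
   F e1 = a e1, F e2 = b e1 + d e2 and a d = 1 this reads a^2 = b^2 + d^2, i.e.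
   (a^2 + a b) (a^2 - a b) = 1, and 2 alpha = ln (a^2 + a b). *)
Require Import Defs.
From mathcomp Require Import all_boot all_order all_algebra.
From mathcomp Require Import reals.
From mathcomp Require Import sequences exp ring lra.

Import Order.TTheory GRing.Theory Num.Theory.
Local Open Scope ring_scope.

(** * Matrices and vectors in dimension three *)

Lemma det_mx33 (R : comNzRingType) (A : 'M[R]_3) :
  \det A = A 0 0 * (A 1 1 * A 2 2 - A 1 2 * A 2 1)
         - A 0 1 * (A 1 0 * A 2 2 - A 1 2 * A 2 0)
         + A 0 2 * (A 1 0 * A 2 1 - A 1 1 * A 2 0).
Proof.
(* Reading entries through natural-number indices identifies the lifted ordinals of the cofactor
   expansion with the numerals of the statement. *)
pose N i j := A (inord i) (inord j).
have AN i j : A i j = N (val i) (val j) by rewrite /N !inord_val.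
rewrite (expand_det_row _ 0) !big_ord_recl big_ord0 /cofactor.
do ![rewrite (expand_det_row _ 0) !big_ord_recl big_ord0 /cofactor].
by rewrite !det_mx00 !mxE !AN /=; ring.
Qed.

Lemma sum_ord3 (V : nmodType) (f : 'I_3 -> V) :
  \sum_(i < 3) f i = f 0 + f 1 + f 2.
Proof.
rewrite !big_ord_recl big_ord0 addr0 addrA.
by congr (_ + f _ + f _); exact/val_inj.
Qed.

Lemma forall_ord3 (P : 'I_3 -> Prop) : P 0 -> P 1 -> P 2 -> forall i, P i.
Proof.
move=> P0 P1 P2 [[|[|[|//]]] lti].
- by rewrite (_ : Ordinal lti = 0) //; exact/val_inj.
- by rewrite (_ : Ordinal lti = 1) //; exact/val_inj.
- by rewrite (_ : Ordinal lti = 2) //; exact/val_inj.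
Qed.

Lemma sqnorm_gt0 (R : realDomainType) n (x : 'cV[R]_n) :
  x != 0 -> 0 < (x^T *m x) 0 0.
Proof.
move=> x0; rewrite mxE lt_def sumr_ge0 ?andbT; last first.
  by move=> i _; rewrite mxE -expr2 sqr_ge0.
apply: contra x0; rewrite psumr_eq0; last first.
  by move=> i _; rewrite mxE -expr2 sqr_ge0.
move=> /allP x0; apply/eqP/colP => i; rewrite [RHS]mxE.
by have := x0 i (mem_index_enum _); rewrite mxE mulf_eq0 orbb => /eqP.
Qed.

Lemma Symp_cauchy_green (R : realType) (F : 'M[R]_3) :
  GLp F -> Symp (F^T *m F).
Proof.
rewrite /GLp => F0; split; first by rewrite /Sym trmx_mul trmxK.
move=> x x0; rewrite mulmxA -trmx_mul -mulmxA; apply: sqnorm_gt0.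
have uF : F \in unitmx by rewrite unitmxE unitfE gt_eqF.
by apply: contra x0 => /eqP Fx; rewrite -[x](mulKmx uF) Fx mulmx0.
Qed.

(** * Half-turns and isotropy *)

(** This is minus the Householder reflection in the plane orthogonal to [v]. *)
Definition half_turn {R : realType} (v : 'cV[R]_3) : 'M[R]_3 :=
  (2 / (v^T *m v) 0 0) *: (v *m v^T) - 1%:M.

Lemma tr_half_turn (R : realType) (v : 'cV[R]_3) :
  (half_turn v)^T = half_turn v.
Proof.
by rewrite /half_turn linearB linearZ /= trmx_mul trmxK trmx1.
Qed.

Lemma half_turnE (R : realType) (v u : 'cV[R]_3) :
  half_turn v *m u = (2 * (v^T *m u) 0 0 / (v^T *m v) 0 0) *: v - u.
Proof.
rewrite mulmxBl mul1mx -scalemxAl -mulmxA.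
by rewrite {1}[v^T *m u]mx11_scalar mul_mx_scalar scalerA mulrAC.
Qed.

Lemma half_turn_fix (R : realType) (v : 'cV[R]_3) :
  v != 0 -> half_turn v *m v = v.
Proof.
move=> /sqnorm_gt0 v0; rewrite half_turnE mulfK ?gt_eqF //.
by rewrite scaler_nat mulr2n addrK.
Qed.

Lemma half_turn_sqr (R : realType) (v : 'cV[R]_3) :
  v != 0 -> half_turn v *m half_turn v = 1%:M.
Proof.
move=> v0; rewrite {2}/half_turn mulmxBr mulmx1 -scalemxAr mulmxA.
by rewrite half_turn_fix // /half_turn subKr.
Qed.

Lemma SO_half_turn (R : realType) (v : 'cV[R]_3) :
  v != 0 -> SO (half_turn v).
Proof.
move=> v0; split; first by rewrite tr_half_turn half_turn_sqr.
have := sqnorm_gt0 _ _ _ v0; rewrite det_mx33 /half_turn.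
set n := (v^T *m v) 0 0 => n0.
have nE : n = v 0 0 * v 0 0 + v 1 0 * v 1 0 + v 2 0 * v 2 0.
  by rewrite /n mxE sum_ord3 !mxE.
rewrite !mxE !big_ord1 !mxE /= {}nE in n0 *.
by field; rewrite gt_eqF.
Qed.

Lemma half_turn_comm (R : realType) (C : 'M[R]_3) (v : 'cV[R]_3) (mu : R) :
  Sym C -> C *m v = mu *: v -> C *m half_turn v = half_turn v *m C.
Proof.
move=> symC Cv; have vC : v^T *m C = mu *: v^T.
  by rewrite -[C in LHS]symC -trmx_mul Cv linearZ.
rewrite /half_turn mulmxBr mulmxBl mulmx1 mul1mx -scalemxAr -scalemxAl.
by rewrite mulmxA Cv -(mulmxA v) vC -scalemxAl -scalemxAr.
Qed.

Lemma isotropic_eigenvector (R : realType) (T : 'M[R]_3 -> 'M[R]_3)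
    (C : 'M[R]_3) (v : 'cV[R]_3) (mu : R) :
  isotropic_biot_response T -> Symp C -> v != 0 -> C *m v = mu *: v ->
  exists lambda : R, T C *m v = lambda *: v.
Proof.
move=> [_ isoT] sC v0 Cv; have := isoT _ _ (SO_half_turn _ _ v0) sC.
rewrite tr_half_turn -(half_turn_comm _ _ _ _ (proj1 sC) Cv) -mulmxA.
rewrite half_turn_sqr // mulmx1 => TC.
have : half_turn v *m (T C *m v) = T C *m v.
  by rewrite {2}TC -!mulmxA half_turn_fix.
(* A vector fixed by the half-turn equals its orthogonal projection onto [v]; both sides appear
   doubled here. *)
rewrite half_turnE => /(canRL (subrK _)) Tv.
exists ((v^T *m (T C *m v)) 0 0 / (v^T *m v) 0 0).
apply: (scalerI (a := 2)); first by rewrite pnatr_eq0.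
by rewrite scalerA mulrA Tv scaler_nat mulr2n.
Qed.

(** * Eigenvectors of the stress and of the strain *)

Lemma pure_shear_stressE (R : realType) (s : R) (v : 'cV[R]_3) :
  pure_shear_stress s *m v =
  \col_i (if i == 0 then s * v 1 0 else if i == 1 then s * v 0 0 else 0).
Proof.
apply/colP; apply: forall_ord3;
  by rewrite !mxE sum_ord3 /tensor !mxE !big_ord1 !mxE /=; ring.
Qed.

(** For v = (x, y, z) the rows read s y = lambda x, s x = lambda y and 0 = lambda z. Requiring x
    nonzero rules out the kernel, spanned by e3. *)
Lemma pure_shear_stress_eigenvector (R : realType) (s lambda : R)
    (v : 'cV[R]_3) :
  s != 0 -> v 0 0 != 0 -> pure_shear_stress s *m v = lambda *: v ->
  v 1 0 ^+ 2 = v 0 0 ^+ 2 /\ v 2 0 = 0.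
Proof.
move=> s0 v0; rewrite pure_shear_stressE => /colP E.
have := E 0; have := E 1; have := E 2; rewrite !mxE /= => E2 E1 E0.
have l0 : lambda != 0.
  by apply: contra_neq v0 => l0; apply: (mulfI s0); rewrite E1 l0 mul0r mulr0.
split; last by apply: (mulfI l0); rewrite -E2 mulr0.
by apply: (mulfI s0); rewrite !expr2 !mulrA E0 E1; ring.
Qed.

(* The characteristic polynomial takes the values - (p - 1) g^2 at 1 and
   (p - 1) q^2 at p. *)
Lemma tridiagonal_root (R : rcfType) (p q r g : R) :
  exists mu : R,
    (p - mu) * ((r - mu) * (1 - mu) - g ^+ 2) - q ^+ 2 * (1 - mu) = 0.
Proof.
pose f : {poly R} := (p%:P - 'X) * ((r%:P - 'X) * (1 - 'X) - (g ^+ 2)%:P)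
                     - (q ^+ 2)%:P * (1 - 'X).
have fE x : f.[x] =
    (p - x) * ((r - x) * (1 - x) - g ^+ 2) - q ^+ 2 * (1 - x).
  by rewrite /f !hornerE.
have f1 : f.[1] = - ((p - 1) * g ^+ 2) by rewrite fE; ring.
have fp : f.[p] = (p - 1) * q ^+ 2 by rewrite fE; ring.
suff [mu /rootP] : exists mu, root f mu by rewrite fE; exists mu.
(* In either order of 1 and p, the value is nonpositive at the left endpoint and nonnegative at the
   right one, as [poly_ivt] requires. *)
have [p1|/ltW p1] := leP 1 p.
  have [|x _ fx] := poly_ivt (p := f) p1; last by exists x.
  rewrite -subr_ge0 in p1.
  by rewrite f1 fp oppr_le0 !(mulr_ge0 p1) ?sqr_ge0.
have [|x _ fx] := poly_ivt (p := f) p1; last by exists x.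
rewrite -subr_le0 in p1.
by rewrite f1 fp oppr_ge0 !(mulr_le0_ge0 p1) ?sqr_ge0.
Qed.

Lemma tridiagonal_eigenvector (R : realType) (p q r g : R) (v : 'cV[R]_3)
    (mu : R) :
  p * v 0 0 + q * v 1 0 = mu * v 0 0 ->
  q * v 0 0 + r * v 1 0 + g * v 2 0 = mu * v 1 0 ->
  g * v 1 0 + v 2 0 = mu * v 2 0 ->
  mx3 [:: [:: p; q; 0]; [:: q; r; g]; [:: 0; g; 1]] *m v = mu *: v.
Proof.
move=> E0 E1 E2; apply/colP; apply: forall_ord3;
  by rewrite !mxE sum_ord3 !mxE /= ?(E0, E1, E2); lra.
Qed.

Lemma tridiagonal_coaxial (R : realType) (p q r g : R) :
  (forall (v : 'cV[R]_3) (mu : R), v 0 0 != 0 ->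
     mx3 [:: [:: p; q; 0]; [:: q; r; g]; [:: 0; g; 1]] *m v = mu *: v ->
     v 1 0 ^+ 2 = v 0 0 ^+ 2 /\ v 2 0 = 0) ->
  g = 0 /\ p = r.
Proof.
move=> coax.
pose V x y z : 'cV[R]_3 := \col_i nth 0 [:: x; y; z] i.
have {}coax x y z mu : x != 0 -> p * x + q * y = mu * x ->
    q * x + r * y + g * z = mu * y -> g * y + z = mu * z ->
    y ^+ 2 = x ^+ 2 /\ z = 0.
  move=> x0 E0 E1 E2; have := coax (V x y z) mu.
  by rewrite !mxE /=; apply=> //; apply: tridiagonal_eigenvector; rewrite !mxE.
(* If q = 0, then e1 is an eigenvector whose second entry vanishes. *)
have q0 : q != 0.
  apply/eqP => q0; have [||||E _] := coax 1 0 0 p;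
    rewrite ?oner_eq0 ?q0 //; try ring.
  by move/eqP: E; rewrite expr0n expr1n eq_sym oner_eq0.
(* If g <> 0, the first two rows of C v = mu v determine v from v 0 0 = q, and
   the third row is the characteristic equation. *)
have g0 : g = 0.
  apply/eqP; apply/negP => /negP g0; have [mu Emu] := tridiagonal_root _ p q r g.
  have gy : g * (mu - p) = (mu - 1) * (((mu - p) * (mu - r) - q ^+ 2) / g).
    by apply: (mulIf g0); rewrite -[RHS]mulrA divfK //; lra.
  have [|||E z0] := coax q (mu - p) (((mu - p) * (mu - r) - q ^+ 2) / g) mu q0.
  - by ring.
  - by rewrite [g * _]mulrC divfK //; ring.
  - by rewrite gy; ring.
  (* With z = 0 the third row gives g (mu - p) = 0, so the second entry mu - p vanishes while the
     first is q. *)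
  move: gy; rewrite z0 mulr0 => /eqP; rewrite mulf_eq0 (negPf g0) /= => /eqP gy.
  by move: E; rewrite gy expr0n => /esym/eqP; rewrite sqrf_eq0 (negPf q0).
(* Here [w] is the root of the discriminant of the upper left block, whose larger eigenvalue mu = (p
   + r + w) / 2 has the eigenvector (q, mu - p). *)
split=> //; pose w := Num.sqrt ((p - r) ^+ 2 + 4 * q ^+ 2).
have w2 : w ^+ 2 = (p - r) ^+ 2 + 4 * q ^+ 2.
  by rewrite sqr_sqrtr // addr_ge0 ?sqr_ge0 // mulr_ge0 ?sqr_ge0.
have [|||y2 _] := coax q ((r - p + w) / 2) 0 ((p + r + w) / 2) q0; rewrite ?g0.
- by field.
- by lra.
- by ring.
have /eqP : (r - p) * (r - p + w) = 0 by lra.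
rewrite mulf_eq0 => /orP[|/eqP rw]; first by rewrite subr_eq0 => /eqP.
suff : q = 0 by move/eqP: q0.
by apply/eqP; rewrite -sqrf_eq0 -y2 rw mul0r expr0n.
Qed.

(** * Hyperbolic parametrization *)

Lemma expR_cosh_sinh (R : realType) (x u v : R) :
  (u + v) * (u - v) = 1 -> expR x = u + v -> cosh x = u /\ sinh x = v.
Proof.
move=> uv xE; rewrite /cosh /sinh expRN xE.
have -> : (u + v)^-1 = u - v.
  have uv0 : u + v != 0 by rewrite -xE gt_eqF ?expR_gt0.
  by apply: (mulfI uv0); rewrite divff // uv.
by split; field.
Qed.

(** The parameter satisfies cosh (2 alpha) = a^2 and sinh (2 alpha) = a b, so the normalizing factor
    is 1 / a = d. *)
Lemma right_simple_shearP (R : realType) (a b d : R) :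
  0 < a -> a * d = 1 -> a ^+ 2 = b ^+ 2 + d ^+ 2 ->
  exists alpha : R,
    mx3 [:: [:: a; b; 0]; [:: 0; d; 0]; [:: 0; 0; 1]] = right_simple_shear alpha.
Proof.
move=> a0 ad abd; have an0 : a != 0 by rewrite gt_eqF.
have dE : d = a^-1 by apply: (mulfI an0); rewrite ad divff.
have prod1 : (a ^+ 2 + a * b) * (a ^+ 2 - a * b) = 1.
  have d2 : a ^+ 2 - b ^+ 2 = d ^+ 2 by lra.
  transitivity (a ^+ 2 * (a ^+ 2 - b ^+ 2)); first by ring.
  by rewrite d2 -exprMn ad expr1n.
(* The two factors of [prod1] have a positive product and the positive sum 2 a^2, so the logarithm
   is applied to a positive number. *)
have pos : 0 < a ^+ 2 + a * b.
  have a2 : 0 < a ^+ 2 by rewrite exprn_gt0.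
  rewrite ltNge; apply/negP => le0.
  have := mulr_le0_ge0 le0 (_ : 0 <= a ^+ 2 - a * b).
  by rewrite prod1 ler10 => H; have /H : 0 <= a ^+ 2 - a * b by lra.
exists (ln (a ^+ 2 + a * b) / 2); rewrite /right_simple_shear.
rewrite [2 * _]mulrC divfK ?pnatr_eq0 //.
have [|-> ->] := expR_cosh_sinh _ (ln (a ^+ 2 + a * b)) _ _ prod1.
  by rewrite lnK.
rewrite sqrtr_sqr gtr0_norm //.
by apply/matrixP; apply: forall_ord3; apply: forall_ord3;
  rewrite !mxE /= ?dE; field.
Qed.

(** Negating the first two rows of [F] preserves [F^T *m F] and the shear conditions; [hdir] selects
    the sign for which the conclusion can hold. *)
Theorem theoremA3 (R : realType) (T : 'M[R]_3 -> 'M[R]_3) (F : 'M[R]_3) (s : R)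
    (hT : isotropic_biot_response T)
    (hF : GLp F)
    (hshear : idealized_shear F)
    (hdir : 0 < F 0 0)
    (hs : s != 0)
    (hstress : T (F^T *m F) = pure_shear_stress s) :
  exists alpha : R, F = right_simple_shear alpha.
Proof.
have [detF Fe3 [l Fe1]] := hshear.
have colE j : F *m delta_mx j (0 : 'I_1) = col j F by rewrite colE.
rewrite /e1 colE in Fe1; rewrite /e3 colE in Fe3.
have Fi0 i : F i 0 = l * (i == 0)%:R.
  by have /colP/(_ i) := Fe1; rewrite !mxE eqxx andbT.
have Fi2 i : F i 2 = (i == 2)%:R.
  by have /colP/(_ i) := Fe3; rewrite !mxE eqxx andbT.
have lE : l = F 0 0 by rewrite Fi0 mulr1.
(* The shear conditions fix the first column up to its top entry and the whole third column. They
   leave [F 2 1] free; it vanishes only through the stress. *)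
have {l lE Fe1 Fe3 Fi0 Fi2 colE} FE : F = mx3 [:: [:: F 0 0; F 0 1; 0];
    [:: 0; F 1 1; 0]; [:: 0; F 2 1; 1]].
  apply/matrixP; apply: forall_ord3; apply: forall_ord3;
  by rewrite !mxE /= ?Fi2 // Fi0 mulr0.
move: FE hdir; set a := F 0 0; set b := F 0 1; set d := F 1 1; set g := F 2 1.
move=> FE a0.
have CE : F^T *m F = mx3 [:: [:: a ^+ 2; a * b; 0];
    [:: a * b; b ^+ 2 + d ^+ 2 + g ^+ 2; g]; [:: 0; g; 1]].
  apply/matrixP; apply: forall_ord3; apply: forall_ord3;
  by rewrite mxE sum_ord3 FE !mxE /=; ring.
have [|g0 abd] := @tridiagonal_coaxial R (a ^+ 2) (a * b)
    (b ^+ 2 + d ^+ 2 + g ^+ 2) g.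
  move=> v mu v0; rewrite -CE => Cv.
  have vn0 : v != 0 by apply: contra_neq v0 => ->; rewrite mxE.
  have [lambda] :=
    isotropic_eigenvector _ _ _ _ _ hT (Symp_cauchy_green _ _ hF) vn0 Cv.
  by rewrite hstress; exact: pure_shear_stress_eigenvector.
have ad : a * d = 1 by rewrite -detF det_mx33 FE !mxE /=; ring.
rewrite FE g0; apply: right_simple_shearP => //.
by rewrite abd g0 expr0n addr0.
Qed.
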